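(* Let $\Phi$ be a Monotone $\{3,6\}$-in-9 SAT formula with $n$ variables and $m\ge1$ clauses $C_1,\dots,C_m$, and let $G$ be the weighted graph on $n+m$ vertices constructed from $\Phi$ as described in the context. Then all edge weights of $G$ are nonnegative integers bounded by $3m$, $\operatorname{SDP}(G)=36m$, and $$\operatorname{SDP}(G)-\operatorname{MC}(G)=\frac14\min_{z\in\{-1,1\}^{n+m}}\ \sum_{j=1}^m\Bigl(\sum_{i\in C_j}z_i+3z_{n+j}\Bigr)^2 .$$ Moreover, $\operatorname{SDP}(G)=\operatorname{MC}(G)$ if and only if $\Phi$ is satisfiable.
   Context: A Monotone $\{3,6\}$-in-9 SAT formula has Boolean variables indexed by $\{1,\dots,n\}$ and clauses $C_j\subseteq\{1,\dots,n\}$, each containing exactly nine distinct unnegated variables; a clause is satisfied if and only if exactly three or exactly six of its variables are assigned true, and the formula is satisfiable if some assignment satisfies all clauses. Construction: $G$ has one vertex $i\in\{1,\dots,n\}$ for each variable and one private auxiliary vertex $n+j$ for each clause $C_j$. Let $a_j\in\mathbb Z^{n+m}$ have $(a_j)_i=1$ for $i\in C_j$, $(a_j)_{n+j}=3$, and all other entries zero. Put $M=\sum_{j=1}^ma_ja_j^\top$; the edge weights of $G$ are $W_{uv}=M_{uv}$ for $u\ne v$ and $W_{uu}=0$. For a graph with symmetric nonnegative weight matrix $W$ (zero diagonal) on $N$ vertices, $$\operatorname{MC}(G)=\max_{x\in\{-1,1\}^N}\frac14\sum_{u\ne v}W_{uv}(1-x_ux_v),\qquad \operatorname{SDP}(G)=\max_{X\succeq0,\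 X_{uu}=1}\frac14\sum_{u\ne v}W_{uv}(1-X_{uv}),$$ where sums are over ordered pairs of distinct vertices and $X$ ranges over real symmetric $N\times N$ matrices. *)

(* Defs.v *)
From HB Require Import structures.
From mathcomp Require Import all_boot all_order all_algebra.
From mathcomp Require Import classical_sets reals.
Set Implicit Arguments.
Unset Strict Implicit.
Unset Printing Implicit Defensive.
Import Order.TTheory GRing.Theory Num.Theory.
Local Open Scope classical_set_scope.
Local Open Scope ring_scope.

(** A formula with [n] variables and [m] clauses is a family
    [C : 'I_m -> {set 'I_n}] (repeated clauses are allowed). *)

Definition nine_clauses (n m : nat) (C : 'I_m -> {set 'I_n}) : Prop :=
  forall j : 'I_m, #|C j| = 9%N.

Definition clause_satisfied (n : nat) (c : {set 'I_n})
    (s : {ffun 'I_n -> bool}) : Prop :=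
  #|[set i in c | s i]| = 3%N \/ #|[set i in c | s i]| = 6%N.

Definition satisfiable (n m : nat) (C : 'I_m -> {set 'I_n}) : Prop :=
  exists s : {ffun 'I_n -> bool}, forall j : 'I_m, clause_satisfied (C j) s.

(** In ['I_(n + m)], the variable [i] is the vertex [lshift m i] and the
    auxiliary vertex of clause [j] is [rshift n j]. *)

Definition clause_vec (n m : nat) (C : 'I_m -> {set 'I_n}) (j : 'I_m)
    : 'cV[int]_(n + m) :=
  \col_u match split u with
         | inl i => if i \in C j then 1 else 0
         | inr k => if k == j then 3 else 0
         end.

Definition clause_gram (n m : nat) (C : 'I_m -> {set 'I_n})
    : 'M[int]_(n + m) :=
  \sum_(j < m) clause_vec C j *m (clause_vec C j)^T.

Definition formula_weights (n m : nat) (C : 'I_m -> {set 'I_n})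
    : 'M[int]_(n + m) :=
  \matrix_(u, v) (if u == v then 0 else clause_gram C u v).

Definition sign_vectors (R : realType) (N : nat) : set 'cV[R]_N :=
  [set x | forall u : 'I_N, x u 0 = -1 \/ x u 0 = 1].
Arguments sign_vectors : clear implicits.

Definition psd (R : realType) (N : nat) (X : 'M[R]_N) : Prop :=
  X^T = X /\ forall v : 'cV[R]_N, 0 <= (v^T *m X *m v) 0 0.

Definition elliptope (R : realType) (N : nat) : set 'M[R]_N :=
  [set X | psd X /\ forall u : 'I_N, X u u = 1].
Arguments elliptope : clear implicits.

Definition cut_value (R : realType) (N : nat) (W : 'M[R]_N) (x : 'cV[R]_N) : R :=
  4^-1 * \sum_(u < N) \sum_(v < N | u != v) W u v * (1 - x u 0 * x v 0).

Definition sdp_value (R : realType) (N : nat) (W X : 'M[R]_N) : R :=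
  4^-1 * \sum_(u < N) \sum_(v < N | u != v) W u v * (1 - X u v).

(** The maximum over sign vectors is over a finite nonempty set, so it is the
    supremum. *)
Definition MC (R : realType) (N : nat) (W : 'M[R]_N) : R :=
  sup [set cut_value W x | x in sign_vectors R N].

(** That this supremum is attained is part of the theorem. *)
Definition SDP (R : realType) (N : nat) (W : 'M[R]_N) : R :=
  sup [set sdp_value W X | X in elliptope R N].

Definition clause_residual (R : realType) (n m : nat)
    (C : 'I_m -> {set 'I_n}) (z : 'cV[R]_(n + m)) : R :=
  \sum_(j < m)
    (\sum_(i in C j) z (lshift m i) 0 + 3 * z (rshift n j) 0) ^+ 2.

(* Main.v *)
Require Import Defs.
From mathcomp Require Import all_boot all_order all_algebra.
From mathcomp Require Import classical_sets reals.
From mathcomp Require Import ring lra zify.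
Import Order.TTheory GRing.Theory Num.Theory.
Local Open Scope classical_set_scope.
Local Open Scope ring_scope.

(** Write [a_j] for the vector of clause [j]. The weights agree off the
    diagonal with [\sum_j a_j a_j^T], and the diagonal does not matter when
    [X u u = 1], so the objective at such an [X] is
    [4^-1 * \sum_j ((\sum_u a_j u) ^+ 2 - a_j^T X a_j)]. Since a clause has nine
    variables and its auxiliary entry is [3], the coordinates of [a_j] sum to
    [12], and the objective equals [36 m] minus a quarter of
    [\sum_j a_j^T X a_j] ([sdp_value_clauses]).

    For positive semidefinite [X] this is at most [36 m]. Equality is reached
    by a Gram matrix: give the variables orthonormal vectors [e_i]; the sum of
    the nine vectors of a clause then has length exactly [3], so that
    [- 3^-1 * \sum_(i in C j) e_i] is a unit vector for the auxiliary vertex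
    and [\sum_u a_j u B_u = 0] for every clause at once
    ([clause_frame_orthogonal]).

    Sign vectors correspond to [X = x x^T], where [a_j^T X a_j] is the [j]-th
    square of the residual; hence the gap is a quarter of the least residual.
    It vanishes exactly when some [z] has [\sum_(i in C j) z_i = - 3 z_(n + j)]
    for all [j]; as [z_(n + j)] is a free sign, this asks that each clause sum
    [2 p - 9], with [p] the number of true variables, be [3] or [-3], that is,
    [p = 6] or [p = 3]. *)

(** * Attained suprema and infima *)

Lemma sup_attained (R : realType) (A : set R) (x : R) :
  A x -> ubound A x -> sup A = x.
Proof.
move=> Ax ubx; apply/le_anti/andP; split; first by apply: ge_sup => //; exists x.
by apply: ub_le_sup => //; exists x.
Qed.

Lemma inf_attained (R : realType) (A : set R) (x : R) :
  A x -> lbound A x -> inf A = x.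
Proof.
move=> Ax lbx; apply/le_anti/andP; split; last by apply: lb_le_inf => //; exists x.
by apply: ge_inf => //; exists x.
Qed.

(** * Sign vectors *)

Definition sign_vector (R : realType) (N : nat) (s : {ffun 'I_N -> bool})
    : 'cV[R]_N :=
  \col_u (if s u then 1 else -1).

Lemma sign_vector_sign (R : realType) N (s : {ffun 'I_N -> bool}) :
  sign_vectors R N (sign_vector R N s).
Proof. by move=> u; rewrite mxE; case: (s u); [right | left]. Qed.

Lemma sign_vectorP (R : realType) N (x : 'cV[R]_N) :
  sign_vectors R N x -> exists s, x = sign_vector R N s.
Proof.
move=> xs; exists [ffun u => x u 0 == 1]; apply/matrixP => u v.
rewrite (ord1 v) !mxE ffunE; case: (xs u) => ->; last by rewrite eqxx.
by case: eqP => // /eqP; rewrite eq_sym -subr_eq0 opprK -(natrD _ 1 1) pnatr_eq0.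
Qed.

Lemma sign_vectors_argmin (R : realType) N (f : 'cV[R]_N -> R) :
  exists2 z, sign_vectors R N z &
    forall x, sign_vectors R N x -> f z <= f x.
Proof.
pose g s := f (sign_vector R N s).
have [s _ smin] := @Order.TotalTheory.arg_minP _ _ _ [ffun=> true] xpredT g isT.
exists (sign_vector R N s); first exact: sign_vector_sign.
by move=> x /sign_vectorP [t ->]; apply: smin.
Qed.

(** * Gram matrices *)

Lemma gram_quadratic (R : realType) N p (B : 'M[R]_(N, p)) (v : 'cV[R]_N) :
  (v^T *m (B *m B^T) *m v) 0 0 = \sum_k (\sum_u v u 0 * B u k) ^+ 2.
Proof.
have -> : v^T *m (B *m B^T) *m v = (v^T *m B) *m (v^T *m B)^T.
  by rewrite trmx_mul trmxK !mulmxA.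
rewrite mxE; apply: eq_bigr => k _; rewrite [in X in _ * X]mxE -expr2.
by congr (_ ^+ 2); rewrite mxE; apply: eq_bigr => u _; rewrite mxE.
Qed.

Lemma gram_elliptope (R : realType) N p (B : 'M[R]_(N, p)) :
  (forall u, \sum_k B u k ^+ 2 = 1) -> elliptope R N (B *m B^T).
Proof.
move=> B1; split; last first.
  by move=> u; rewrite mxE -[RHS](B1 u); apply: eq_bigr => k _; rewrite mxE.
split; first by rewrite trmx_mul trmxK.
by move=> v; rewrite gram_quadratic sumr_ge0 // => k _; rewrite sqr_ge0.
Qed.

Lemma rank_one_elliptope (R : realType) N (x : 'cV[R]_N) :
  sign_vectors R N x -> elliptope R N (x *m x^T).
Proof.
move=> xs; apply: gram_elliptope => u; rewrite big_ord1.
by case: (xs u) => ->; rewrite ?sqrrN expr1n.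
Qed.

Lemma cut_value_rank_one (R : realType) N (W : 'M[R]_N) (x : 'cV[R]_N) :
  cut_value W x = sdp_value W (x *m x^T).
Proof.
congr (_ * _); apply: eq_bigr => u _; apply: eq_bigr => v _.
by rewrite mxE big_ord1 mxE.
Qed.

(** * Clause vectors and the objective *)

Section Clauses.
Variables (n m : nat) (C : 'I_m -> {set 'I_n}).

Lemma clause_vec_dot (R : realType) (j : 'I_m) (f : 'I_(n + m) -> R) :
  \sum_u (clause_vec C j u 0)%:~R * f u
  = \sum_(i in C j) f (lshift m i) + 3 * f (rshift n j).
Proof.
rewrite big_split_ord /=; congr (_ + _).
  rewrite [RHS]big_mkcond; apply: eq_bigr => i _; rewrite mxE.
  by rewrite (unsplitK (inl i)); case: ifP; rewrite ?mul1r ?mul0r.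
rewrite (bigD1 j) //= mxE (unsplitK (inr j)) eqxx.
rewrite big1 ?addr0 // => k kj.
by rewrite mxE (unsplitK (inr k)) (negbTE kj) mul0r.
Qed.

Lemma clause_gramE (u v : 'I_(n + m)) :
  clause_gram C u v = \sum_j clause_vec C j u 0 * clause_vec C j v 0.
Proof.
by rewrite summxE; apply: eq_bigr => j _; rewrite mxE big_ord1 [_^T _ _]mxE.
Qed.

(** Off the diagonal every clause contributes at most [3]: its product of
    entries is [1 * 1], [1 * 3] or [0], because the value [3] occurs only once
    in a clause vector and [3 * 3] therefore only on the diagonal. *)
Lemma formula_weights_bounded (u v : 'I_(n + m)) :
  0 <= formula_weights C u v <= 3 * m%:Z.
Proof.
rewrite mxE; case: eqP => [_|/eqP uv]; first by lia.
rewrite clause_gramE; apply/andP; split.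
  apply: sumr_ge0 => j _; rewrite !mxE.
  by rewrite mulr_ge0 //; case: split => a; case: ifP.
have -> : 3 * m%:Z = \sum_(j < m) 3.
  by rewrite sumr_const card_ord -[Posz m]natz mulr_natr.
apply: ler_sum => j _; rewrite !mxE.
case Eu: (split u) => [a|a]; case Ev: (split v) => [b|b];
  try by case: ifP; case: ifP.
case: ifP => [/eqP aj|_]; last by rewrite mul0r.
case: ifP => [/eqP bj|_]; last by rewrite mulr0.
by case/eqP: uv; rewrite -(splitK u) -(splitK v) Eu Ev aj bj.
Qed.

Definition clause_form (R : realType) (j : 'I_m) (X : 'M[R]_(n + m)) : R :=
  let a : 'cV[R]_(n + m) := map_mx intr (clause_vec C j) in
  (a^T *m X *m a) 0 0.

Lemma clause_formE (R : realType) j (X : 'M[R]_(n + m)) :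
  clause_form R j X
  = \sum_u \sum_v (clause_vec C j u 0)%:~R * (clause_vec C j v 0)%:~R * X u v.
Proof.
rewrite /clause_form mxE exchange_big; apply: eq_bigr => v _.
rewrite mxE mulr_suml; apply: eq_bigr => u _; rewrite !mxE.
by rewrite mulrAC.
Qed.

Lemma clause_form_gram (R : realType) j p (B : 'M[R]_(n + m, p)) :
  clause_form R j (B *m B^T)
  = \sum_k (\sum_(i in C j) B (lshift m i) k + 3 * B (rshift n j) k) ^+ 2.
Proof.
rewrite /clause_form gram_quadratic; apply: eq_bigr => k _; congr (_ ^+ 2).
by rewrite -(clause_vec_dot R j (B^~ k)); apply: eq_bigr => u _; rewrite mxE.
Qed.

Hypothesis hC : nine_clauses C.

Lemma clause_vec_sum (R : realType) j :
  \sum_u (clause_vec C j u 0)%:~R = 12 :> R.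
Proof.
have := clause_vec_dot R j (fun=> 1); rewrite sumr_const hC mulr1 -natrD => <-.
by apply: eq_bigr => u _; rewrite mulr1.
Qed.

Lemma sdp_value_clauses (R : realType) (X : 'M[R]_(n + m)) :
  (forall u, X u u = 1) ->
  sdp_value (map_mx intr (formula_weights C)) X
  = 36 * m%:R - 4^-1 * \sum_j clause_form R j X.
Proof.
move=> X1; pose a j u : R := (clause_vec C j u 0)%:~R.
(* The diagonal terms may be added back because [1 - X u u = 0]. *)
have full : \sum_u \sum_(v | u != v)
      (map_mx intr (formula_weights C) : 'M[R]__) u v * (1 - X u v)
    = \sum_u \sum_v \sum_j a j u * a j v * (1 - X u v).
  apply: eq_bigr => u _; rewrite big_mkcond; apply: eq_bigr => v _ /=.
  rewrite -mulr_suml; have [<-|uv] := eqVneq u v.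
    by rewrite X1 subrr !mulr0.
  rewrite !mxE (negbTE uv) clause_gramE rmorph_sum /=; congr (_ * _).
  by apply: eq_bigr => j _; rewrite intrM.
have split_clause j : \sum_u \sum_v a j u * a j v * (1 - X u v)
    = 144 - clause_form R j X.
  have -> : 144 = \sum_u \sum_v a j u * a j v.
    under eq_bigr do rewrite -mulr_sumr.
    by rewrite -mulr_suml !clause_vec_sum -natrM.
  rewrite clause_formE -sumrB; apply: eq_bigr => u _.
  by rewrite -sumrB; apply: eq_bigr => v _; rewrite mulrBr mulr1.
rewrite /sdp_value full.
under eq_bigr do rewrite exchange_big.
rewrite exchange_big /=; under eq_bigr do rewrite split_clause.
by rewrite sumrB sumr_const card_ord -[_ *+ m]mulr_natr; field.
Qed.

Lemma cut_value_residual (R : realType) (x : 'cV[R]_(n + m)) :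
  sign_vectors R (n + m) x ->
  cut_value (map_mx intr (formula_weights C)) x
  = 36 * m%:R - 4^-1 * clause_residual C x.
Proof.
move=> xs; rewrite cut_value_rank_one sdp_value_clauses; last first.
  by case: (rank_one_elliptope _ _ _ xs).
by congr (_ - _ * _); apply: eq_bigr => j _; rewrite clause_form_gram big_ord1.
Qed.

(** * The optimum of the relaxation *)

(** Row [u] is the unit vector of vertex [u]: an orthonormal frame on the
    variables, and on each clause vertex the opposite of the normalised sum of
    its variables. *)
Definition clause_frame (R : realType) : 'M[R]_(n + m, n) :=
  col_mx 1%:M (\matrix_(j, k) if k \in C j then - 3^-1 else 0).

Lemma clause_frame_unit (R : realType) u :
  \sum_k clause_frame R u k ^+ 2 = 1.
Proof.
rewrite -(splitK u); case: (split u) => [i|j] /=.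
  rewrite (bigD1 i) //= col_mxEu mxE eqxx expr1n big1 ?addr0 // => k ki.
  by rewrite col_mxEu mxE eq_sym (negbTE ki) expr0n.
transitivity (\sum_(k in C j) (9%:R^-1 : R)).
  rewrite [RHS]big_mkcond; apply: eq_bigr => k _; rewrite col_mxEd mxE.
  by case: ifP => _; rewrite ?expr0n // sqrrN exprVn -natrX.
by rewrite sumr_const hC -[LHS]mulr_natr mulVf // pnatr_eq0.
Qed.

Lemma clause_frame_orthogonal (R : realType) j :
  clause_form R j (clause_frame R *m (clause_frame R)^T) = 0.
Proof.
rewrite clause_form_gram big1 // => k _; rewrite col_mxEd mxE.
under eq_bigr do rewrite col_mxEu mxE.
have -> : \sum_(i in C j) ((i == k)%:R : R) = (k \in C j)%:R.
  have off i : i != k -> (i == k)%:R = 0 :> R by move/negbTE ->.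
  case: (boolP (k \in C j)) => kC.
    by rewrite (bigD1 k) //= eqxx big1 ?addr0 // => i /andP [_ /off].
  by apply: big1 => i iC; apply: off; apply: contraNneq kC => <-.
by case: ifP => _; rewrite ?mulrN ?mulfV ?pnatr_eq0 // ?mulr0 ?addr0 ?subrr expr0n.
Qed.

Lemma SDP_attained (R : realType) :
  let W : 'M[R]_(n + m) := map_mx intr (formula_weights C) in
  SDP W = 36 * m%:R /\
  exists2 X : 'M[R]_(n + m), elliptope R (n + m) X & sdp_value W X = SDP W.
Proof.
move=> W; pose X := clause_frame R *m (clause_frame R)^T.
have eX : elliptope R (n + m) X by exact/gram_elliptope/clause_frame_unit.
have vX : sdp_value W X = 36 * m%:R.
  rewrite sdp_value_clauses; last by case: eX.
  by rewrite big1 ?mulr0 ?subr0 // => j _; apply: clause_frame_orthogonal.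
have SDPE : SDP W = 36 * m%:R.
  apply: sup_attained; first by exists X.
  move=> _ [Y [[_ Yge0] Y1] <-]; rewrite sdp_value_clauses // gerBl.
  by rewrite mulr_ge0 ?invr_ge0 ?sumr_ge0 // => j _; apply: Yge0.
by split; rewrite ?SDPE //; exists X.
Qed.

(** * The gap and satisfiability *)

Lemma sum_of_signs (R : realType) (c : {set 'I_n}) (s : {ffun 'I_n -> bool}) :
  \sum_(i in c) (if s i then 1 else -1) = 2 * #|[set i in c | s i]|%:R - #|c|%:R :> R.
Proof.
have -> : #|[set i in c | s i]|%:R = \sum_(i in c) (s i)%:R :> R.
  rewrite -natr_sum -big_mkcondr /= sum1_card; congr (_%:R).
  by apply: eq_card => i; rewrite inE.
rewrite -sum1_card natr_sum mulr_sumr -sumrB; apply: eq_bigr => i _.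
by case: (s i) => /=; ring.
Qed.

Lemma residual_zero_satisfiable (R : realType) :
  (exists2 z, sign_vectors R (n + m) z & clause_residual C z = 0)
  <-> satisfiable C.
Proof.
split=> [[_ /sign_vectorP [t ->] /eqP]|[s sat]].
  rewrite psumr_eq0 => [/allP res0|j _]; last exact: sqr_ge0.
  exists [ffun i => t (lshift m i)] => j.
  have /= := res0 j (mem_index_enum j); rewrite sqrf_eq0 => /eqP.
  under eq_bigr do rewrite mxE -[t _](ffunE (fun i => t (lshift m i))).
  rewrite sum_of_signs hC mxE /clause_satisfied; set p := #|_|.
  case: (t _) => E; [left | right]; apply/eqP; rewrite -(eqr_nat R);
    apply/eqP; lra.
(* A clause with three true variables sums to [-3], one with six to [3]; the
   auxiliary sign is chosen to cancel it. *)
pose t := [ffun u => match split u with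
  | inl i => s i | inr j => #|[set i in C j | s i]| == 3%N end].
exists (sign_vector R (n + m) t); first exact: sign_vector_sign.
apply: big1 => j _; under eq_bigr do rewrite mxE ffunE (unsplitK (inl _)).
rewrite sum_of_signs hC mxE ffunE (unsplitK (inr _)).
by case: (sat j) => -> /=; ring.
Qed.

End Clauses.

Theorem mainTheorem8 (R : realType) (n m : nat) (C : 'I_m -> {set 'I_n})
    (hC : nine_clauses C) (hm : (1 <= m)%N) :
  let W : 'M[R]_(n + m) := map_mx intr (formula_weights C) in
  [/\ forall u v : 'I_(n + m), 0 <= formula_weights C u v <= 3 * m%:Z,
      SDP W = 36 * m%:R,
      exists2 X : 'M[R]_(n + m), elliptope R (n + m) X & sdp_value W X = SDP W,
      SDP W - MC W =
        4^-1 * inf [set clause_residual C z | z in sign_vectors R (n + m)]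
    & SDP W = MC W <-> satisfiable C].
Proof.
move=> W; have [SDPE SDPX] := SDP_attained n m C hC R.
have [z zs zmin] := sign_vectors_argmin R (n + m) (@clause_residual R n m C).
have MCE : MC W = 36 * m%:R - 4^-1 * clause_residual C z.
  apply: sup_attained; first by exists z => //; apply: cut_value_residual.
  move=> _ [x xs <-]; rewrite cut_value_residual //.
  by have := zmin x xs; lra.
have infE : inf [set clause_residual C x | x in sign_vectors R (n + m)]
    = clause_residual C z.
  by apply: inf_attained; [exists z | move=> _ [x xs <-]; apply: zmin].
split=> //; first by move=> u v; apply: formula_weights_bounded.
  by rewrite infE SDPE MCE; ring.
rewrite -(residual_zero_satisfiable n m C hC R) SDPE MCE.
split=> [E|[x xs x0]]; first by exists z => //; lra.
have z0 : 0 <= clause_residual C z by apply: sumr_ge0 => j _; apply: sqr_ge0.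
by have := zmin x xs; rewrite x0; lra.
Qed.
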